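(* Let $\mathcal C$ be an abelian category and let $X,Y:\mathcal C\to\mathcal C$ be endofunctors such that $Y$ is both left and right adjoint to $X$ and such that the biproducts $\bigoplus_{i\ge0}X^i(M)$ and $\bigoplus_{i\ge0}Y^i(M)$ exist for all $M\in\mathcal C$. Then there are isomorphisms of categories $(\tau^-\Downarrow\operatorname{Id})\cong\mathcal C^{\Pi(X)}\cong(\operatorname{Id}\Downarrow\tau)$ which commute with the forgetful functors from these three categories to $\mathcal C^{T(X)}$.
   Context: All functors are additive. $X^0=\operatorname{Id}$. The biproduct $\bigoplus_iM_i$ exists if the coproduct and product exist and the canonical morphism $\coprod_iM_i\to\prod_iM_i$ is an isomorphism. Fix adjunctions $X\dashv Y$ and $Y\dashv X$, with units $\eta^{X\dashv Y},\eta^{Y\dashv X}$ and counits $\varepsilon^{X\dashv Y},\varepsilon^{Y\dashv X}$. $\mathcal C^{T(X)}$ is the Eilenberg–Moore category of the free monad $T(X)=\bigoplus_{i\ge0}X^i$; it is identified with the category of pairs $(M,h_1)$ with $h_1:X(M)\to M$ in $\mathcal C$, a morphism $(M,h_1)\to(N,g_1)$ being $\varphi:M\to N$ with $\varphi h_1=g_1X(\varphi)$. It is abelian, with exactness detected in $\mathcal C$. Via $X\dashv Y$, $(M,h_1)$ is equivalently a pair $(M,h_1^\flat:M\to Y(M))$, $h_1^\flat$ being the adjoint of $h_1$. For $M\in\mathcal C$, $f_!(M)=\bigoplus_{i\ge0}X^i(M)$ with structure map the inclusion $X(\bigoplus_{i\ge0}X^iM)=\bigoplus_{i\ge1}X^iM\to\bigoplus_{i\ge0}X^iM$,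 and $f_*(M)=\bigoplus_{i\ge0}Y^i(M)$ with structure map $\bigoplus_{i\ge0}Y^iM\to Y(\bigoplus_{i\ge0}Y^iM)$ the canonical projection. These are left and right adjoint to the forgetful functor $f^*:\mathcal C^{T(X)}\to\mathcal C$. The endofunctors $\tau,\tau^-$ of $\mathcal C^{T(X)}$ are: $\tau(M,h_1)=\operatorname{Ker}(\chi:f_*(X(M))\to f_*(M))$, where $\chi$ has components $\chi_{i,j}:Y^iX(M)\to Y^j(M)$ equal to $-Y^i(h_1)$ if $j=i$, $Y^{i-1}(\varepsilon^{Y\dashv X}_M)$ if $j=i-1$, and $0$ otherwise; dually, $\tau^-(M,h_1)=\operatorname{Coker}(f_!(M)\to f_!(Y(M)))$, where the map has components $X^i(M)\to X^jY(M)$ equal to $-X^i(h_1^\flat)$ if $j=i$, $X^i(\eta^{Y\dashv X}_M)$ if $j=i+1$, and $0$ otherwise. $(\tau^-\Downarrow\operatorname{Id})$ has as objects pairs $(A,\tau^-(A)\xrightarrow{u}A)$ with $A\in\mathcal C^{T(X)}$, and as morphisms $(A,u)\to(B,v)$ the $a:A\to B$ with $au=v\tau^-(a)$. $(\operatorname{Id}\Downarrow\tau)$ has as objects pairs $(A,A\xrightarrow{\psi}\tau(A))$ and as morphisms $(A,\psi)\to(B,\psi')$ the $a:A\to B$ with $\psi'a=\tau(a)\psi$. Their forgetful functors return $A$. $\mathcal C^{\Pi(X)}$ has as objects triples $(M,h_1,h_1')$ with $h_1:X(M)\to M$ and $h_1':Y(M)\to M$ in $\mathcal C$ such that $h_1'\,Y(h_1)\,\eta^{X\dashv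 Y}_M=h_1\,X(h_1')\,\eta^{Y\dashv X}_M$; morphisms are morphisms in $\mathcal C$ commuting with both structure maps. Its forgetful functor is $(M,h_1,h_1')\mapsto(M,h_1)$. *)

(* Defs.v *)
From HB Require Import structures.
From mathcomp Require Import all_boot all_algebra.
From mathcomp Require Import boolp.

Set Implicit Arguments.
Unset Strict Implicit.
Unset Printing Implicit Defensive.

Import GRing.Theory.
Local Open Scope ring_scope.

Declare Scope cat_scope.
Delimit Scope cat_scope with cat.
Open Scope cat_scope.

Reserved Notation "g ∘ f" (at level 40, left associativity).

Record category := Category {
  ob :> Type;
  hom : ob -> ob -> Type;
  idm : forall M, hom M M;
  comp : forall M N P, hom N P -> hom M N -> hom M P;
  comp1m : forall M N (f : hom M N), comp (idm N) f = f;
  compm1 : forall M N (f : hom M N), comp f (idm M) = f;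
  compA : forall M N P Q (h : hom P Q) (g : hom N P) (f : hom M N),
    comp h (comp g f) = comp (comp h g) f
}.
Arguments idm {c} M.

Notation "g ∘ f" := (comp g f) : cat_scope.

Record functor (C D : category) := Functor {
  fob :> C -> D;
  fmap : forall M N : C, hom M N -> hom (fob M) (fob N);
  fmap1 : forall M : C, fmap (idm M) = idm (fob M);
  fmapM : forall (M N P : C) (g : hom N P) (f : hom M N),
    fmap (g ∘ f) = fmap g ∘ fmap f
}.
Arguments fmap {C D} f {M N} : rename.

Definition fid (C : category) : functor C C :=
  @Functor C C id (fun M N f => f) (fun=> erefl) (fun _ _ _ _ _ => erefl).

Section FunctorComposition.
Variables (C D E : category) (G : functor D E) (F : functor C D).

Fact fcomp_fmap1 (M : C) : fmap G (fmap F (idm M)) = idm (G (F M)).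
Proof. by rewrite !fmap1. Qed.

Fact fcomp_fmapM (M N P : C) (g : hom N P) (f : hom M N) :
  fmap G (fmap F (g ∘ f)) = fmap G (fmap F g) ∘ fmap G (fmap F f).
Proof. by rewrite !fmapM. Qed.

Definition fcomp : functor C E :=
  @Functor C E (fun M => G (F M)) (fun M N f => fmap G (fmap F f))
    fcomp_fmap1 fcomp_fmapM.
End FunctorComposition.

(* Strict isomorphism: the composites are equal to the identity functors, on
   objects and on morphisms, and not merely naturally isomorphic to them. *)
Definition is_cat_iso (C D : category) (F : functor C D) : Prop :=
  exists G : functor D C, fcomp G F = fid C /\ fcomp F G = fid D.

Fixpoint fpow (C : category) (X : functor C C) (i : nat) : functor C C :=
  if i is k.+1 then fcomp X (fpow X k) else fid C.

Record adjunction (C D : category) (F : functor C D) (G : functor D C) :=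
  Adjunction {
  unit : forall M : C, hom M (G (F M));
  counit : forall N : D, hom (F (G N)) N;
  unit_nat : forall (M M' : C) (f : hom M M'),
    fmap G (fmap F f) ∘ unit M = unit M' ∘ f;
  counit_nat : forall (N N' : D) (g : hom N N'),
    counit N' ∘ fmap F (fmap G g) = g ∘ counit N;
  triangleF : forall M : C, counit (F M) ∘ fmap F (unit M) = idm (F M);
  triangleG : forall N : D, fmap G (counit N) ∘ unit (G N) = idm (G N)
}.
Arguments unit {C D F G} a M.
Arguments counit {C D F G} a N.

Definition is_iso (C : category) (M N : C) (f : hom M N) : Prop :=
  exists g : hom N M, g ∘ f = idm M /\ f ∘ g = idm N.

Definition is_mono (C : category) (M N : C) (f : hom M N) : Prop :=
  forall (L : C) (u v : hom L M), f ∘ u = f ∘ v -> u = v.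

Definition is_epi (C : category) (M N : C) (f : hom M N) : Prop :=
  forall (P : C) (u v : hom N P), u ∘ f = v ∘ f -> u = v.

Definition is_coproduct (C : category) (I : Type) (F : I -> C) (S : C)
    (inj : forall i, hom (F i) S) : Prop :=
  forall (N : C) (f : forall i, hom (F i) N),
    exists! u : hom S N, forall i, u ∘ inj i = f i.

Definition is_product (C : category) (I : Type) (F : I -> C) (P : C)
    (prj : forall i, hom P (F i)) : Prop :=
  forall (L : C) (f : forall i, hom L (F i)),
    exists! u : hom L P, forall i, prj i ∘ u = f i.

Record precategory_Z := PrecategoryZ {
  pz_cat :> category;
  pz_zmod : forall M N : pz_cat, GRing.Zmodule (hom M N)
}.

HB.instance Definition _ (C : precategory_Z) (M N : C) := @pz_zmod C M N.

Record preadditive := Preadditive {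
  pa_pz :> precategory_Z;
  compDl : forall (M N P : pa_pz) (g g' : hom N P) (f : hom M N),
    (g + g') ∘ f = g ∘ f + g' ∘ f;
  compDr : forall (M N P : pa_pz) (g : hom N P) (f f' : hom M N),
    g ∘ (f + f') = g ∘ f + g ∘ f'
}.

Record addfunctor (C D : preadditive) := AddFunctor {
  af_fun :> functor C D;
  fmapD : forall (M N : C) (f g : hom M N),
    fmap af_fun (f + g) = fmap af_fun f + fmap af_fun g
}.

Section PreadditiveTheory.
Variable C : preadditive.

Lemma comp0m (M N P : C) (f : hom M N) : (0 : hom N P) ∘ f = 0.
Proof. by apply: (addIr ((0 : hom N P) ∘ f)); rewrite -compDl !add0r. Qed.

Lemma compm0 (M N P : C) (g : hom N P) : g ∘ (0 : hom M N) = 0.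
Proof. by apply: (addIr (g ∘ (0 : hom M N))); rewrite -compDr !add0r. Qed.

Lemma compNm (M N P : C) (g : hom N P) (f : hom M N) : (- g) ∘ f = - (g ∘ f).
Proof. by apply: (addIr (g ∘ f)); rewrite -compDl !addNr comp0m. Qed.

Lemma compmN (M N P : C) (g : hom N P) (f : hom M N) : g ∘ (- f) = - (g ∘ f).
Proof. by apply: (addIr (g ∘ f)); rewrite -compDr !addNr compm0. Qed.

Variables (D : preadditive) (X : addfunctor C D).

Lemma fmap0 (M N : C) : fmap X (0 : hom M N) = 0.
Proof. by apply: (addIr (fmap X (0 : hom M N))); rewrite -fmapD !add0r. Qed.

Lemma fmapN (M N : C) (f : hom M N) : fmap X (- f) = - fmap X f.
Proof. by apply: (addIr (fmap X f)); rewrite -fmapD !addNr fmap0. Qed.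
End PreadditiveTheory.

Definition is_kernel (C : preadditive) (M N K : C)
    (f : hom M N) (k : hom K M) : Prop :=
  f ∘ k = 0 /\
  forall (L : C) (g : hom L M), f ∘ g = 0 -> exists! u : hom L K, k ∘ u = g.

Definition is_cokernel (C : preadditive) (M N Q : C)
    (f : hom M N) (q : hom N Q) : Prop :=
  q ∘ f = 0 /\
  forall (P : C) (g : hom N P), g ∘ f = 0 -> exists! u : hom Q P, u ∘ q = g.

Record kernel (C : preadditive) (M N : C) (f : hom M N) := Kernel {
  ker_ob : C;
  ker_mor : hom ker_ob M;
  kerP : is_kernel f ker_mor
}.

Record cokernel (C : preadditive) (M N : C) (f : hom M N) := Cokernel {
  coker_ob : C;
  coker_mor : hom N coker_ob;
  cokerP : is_cokernel f coker_mor
}.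

Record is_abelian (C : preadditive) : Prop := IsAbelian {
  ab_zero : exists Z : C, forall M : C,
    (exists! f : hom M Z, True) /\ (exists! f : hom Z M, True);
  ab_prod : forall F : bool -> C,
    exists (P : C) (prj : forall b, hom P (F b)), is_product prj;
  ab_coprod : forall F : bool -> C,
    exists (S : C) (inj : forall b, hom (F b) S), is_coproduct inj;
  ab_ker : forall (M N : C) (f : hom M N),
    exists (K : C) (k : hom K M), is_kernel f k;
  ab_coker : forall (M N : C) (f : hom M N),
    exists (Q : C) (q : hom N Q), is_cokernel f q;
  ab_mono : forall (M N : C) (f : hom M N), is_mono f ->
    exists (P : C) (g : hom N P), is_kernel g f;
  ab_epi : forall (M N : C) (f : hom M N), is_epi f ->
    exists (L : C) (g : hom L M), is_cokernel g f
}.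

Section KernelTheory.
Variables (C : preadditive) (M N : C) (f : hom M N).

Definition ker_lift (K : kernel f) (L : C) (g : hom L M) (fg0 : f ∘ g = 0) :
  hom L (ker_ob K) := sval (cid ((kerP K).2 L g fg0)).

Lemma ker_liftE (K : kernel f) (L : C) (g : hom L M) (fg0 : f ∘ g = 0) :
  ker_mor K ∘ ker_lift K fg0 = g.
Proof. by rewrite /ker_lift; case: cid => u []. Qed.

Lemma ker_comp0 (K : kernel f) : f ∘ ker_mor K = 0.
Proof. exact: (kerP K).1. Qed.

Lemma ker_mono (K : kernel f) : is_mono (ker_mor K).
Proof.
move=> L u v uv.
have fv0 : f ∘ (ker_mor K ∘ v) = 0 by rewrite compA ker_comp0 comp0m.
have [w [_ wP]] := (kerP K).2 L _ fv0.
by rewrite -(wP u uv) -(wP v erefl).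
Qed.

Definition coker_desc (Q : cokernel f) (P : C) (g : hom N P)
    (gf0 : g ∘ f = 0) : hom (coker_ob Q) P :=
  sval (cid ((cokerP Q).2 P g gf0)).

Lemma coker_descE (Q : cokernel f) (P : C) (g : hom N P) (gf0 : g ∘ f = 0) :
  coker_desc Q gf0 ∘ coker_mor Q = g.
Proof. by rewrite /coker_desc; case: cid => u []. Qed.

Lemma coker_comp0 (Q : cokernel f) : coker_mor Q ∘ f = 0.
Proof. exact: (cokerP Q).1. Qed.

Lemma coker_epi (Q : cokernel f) : is_epi (coker_mor Q).
Proof.
move=> P u v uv.
have vf0 : (v ∘ coker_mor Q) ∘ f = 0 by rewrite -compA coker_comp0 compm0.
have [w [_ wP]] := (cokerP Q).2 P _ vf0.
by rewrite -(wP u uv) -(wP v erefl).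
Qed.
End KernelTheory.

(* The family of morphisms N -> G j whose only nonzero member is f, at k. *)
Definition at_index (C : preadditive) (N : C) (G : nat -> C) (k : nat)
    (f : hom N (G k)) (j : nat) : hom N (G j) :=
  match @eqP _ k j with
  | ReflectT e => eq_rect k (fun j => hom N (G j)) f j e
  | ReflectF _ => 0
  end.
Arguments at_index {C N G} k f j.

Section AtIndexTheory.
Variable C : preadditive.

Lemma at_index_eq (N : C) (G : nat -> C) k (f : hom N (G k)) :
  at_index k f k = f.
Proof. by rewrite /at_index; case: eqP => // e; rewrite (eq_axiomK e). Qed.

Lemma at_index_neq (N : C) (G : nat -> C) k j (f : hom N (G k)) :
  k != j -> at_index k f j = 0.
Proof. by rewrite /at_index; case: eqP. Qed.

Lemma at_index_comp (L N : C) (G : nat -> C) k (f : hom N (G k)) (h : hom L N)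
    j : at_index k f j ∘ h = at_index k (f ∘ h) j.
Proof.
have [<-|ne] := eqVneq k j; first by rewrite !at_index_eq.
by rewrite !at_index_neq ?comp0m.
Qed.

Lemma comp_at_index (N : C) (G H : nat -> C) k (f : hom N (G k))
    (h : forall j, hom (G j) (H j)) j :
  h j ∘ at_index k f j = at_index k (h k ∘ f) j.
Proof.
have [<-|ne] := eqVneq k j; first by rewrite !at_index_eq.
by rewrite !at_index_neq ?compm0.
Qed.

Lemma fmap_at_index (X : addfunctor C C) (N M : C) k (f : hom N (fpow X k M))
    j :
  at_index (G := fun j => fpow X j M) k.+1
    (@fmap _ _ X _ (fpow X k M) f) j.+1
  = @fmap _ _ X _ (fpow X j M) (at_index (G := fun j => fpow X j M) k f j).
Proof.
have [<-|ne] := eqVneq k j; first by rewrite !at_index_eq.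
by rewrite !at_index_neq ?fmap0.
Qed.
End AtIndexTheory.

Section Biproduct.
Variable C : preadditive.

(* can is the canonical morphism from the coproduct to the product, whose
   components are the identities (i = j) and 0 (i <> j). *)
Definition is_canonical (F : nat -> C) (S P : C)
    (inj : forall i, hom (F i) S) (prj : forall i, hom P (F i))
    (can : hom S P) : Prop :=
  forall i j, prj j ∘ can ∘ inj i = at_index i (idm (F i)) j.

(* A coproduct whose canonical morphism to a product is invertible. *)
Record biproduct (F : nat -> C) := Biproduct {
  bip_ob :> C;
  bip_prod : C;
  binj : forall i, hom (F i) bip_ob;
  bip_prj : forall i, hom bip_prod (F i);
  bip_can : hom bip_ob bip_prod;
  bip_coprodP : is_coproduct binj;
  bip_prodP : is_product bip_prj;
  bip_canP : is_canonical binj bip_prj bip_can;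
  bip_isoP : is_iso bip_can
}.

Variables (F : nat -> C) (B : biproduct F).

(* Locked so that [rewrite compA] does not look through the composition;
   likewise below. *)
Definition bprj (j : nat) : hom B (F j) := locked (bip_prj B j ∘ bip_can B).

Definition bcopair (N : C) (f : forall i, hom (F i) N) : hom B N :=
  sval (cid (bip_coprodP B f)).

Definition bpair (L : C) (f : forall j, hom L (F j)) : hom L B :=
  locked (sval (cid (bip_isoP B)) ∘ sval (cid (bip_prodP B f))).

Lemma bprj_inj i j : bprj j ∘ binj B i = at_index i (idm (F i)) j.
Proof. by rewrite /bprj -lock; apply: bip_canP. Qed.

Lemma bcopairE (N : C) (f : forall i, hom (F i) N) i :
  bcopair f ∘ binj B i = f i.
Proof. by rewrite /bcopair; case: cid => u [/= + _]. Qed.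

Lemma bpairE (L : C) (f : forall j, hom L (F j)) j : bprj j ∘ bpair f = f j.
Proof.
rewrite /bpair /bprj -!lock; case: cid => g [/= _ cg]; case: cid => u [/= uE _].
by rewrite -compA [_ ∘ (g ∘ u)]compA cg comp1m.
Qed.

Lemma bip_ext_in (N : C) (u v : hom B N) :
  (forall i, u ∘ binj B i = v ∘ binj B i) -> u = v.
Proof.
move=> uv; have [w [_ wP]] := bip_coprodP B (fun i => v ∘ binj B i).
by rewrite -(wP u uv) -(wP v).
Qed.

Lemma bip_ext_out (L : C) (u v : hom L B) :
  (forall j, bprj j ∘ u = bprj j ∘ v) -> u = v.
Proof.
move=> uv.
have [w [_ wP]] := bip_prodP B (fun j => bip_prj B j ∘ (bip_can B ∘ v)).
have cuv : bip_can B ∘ u = bip_can B ∘ v.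
  rewrite -(wP (bip_can B ∘ u)) ?(wP (bip_can B ∘ v)) // => j.
  by have := uv j; rewrite /bprj -lock !compA.
have [g [gc _]] := bip_isoP B.
by rewrite -(comp1m u) -(comp1m v) -gc -!compA cuv.
Qed.
End Biproduct.
Arguments binj {C F} b i.
Arguments bprj {C F} B j.
Arguments bcopair {C F} B {N} f.
Arguments bpair {C F} B {L} f.

Section Matrix.
Variables (C : preadditive) (F G : nat -> C).
Variables (B : biproduct F) (D : biproduct G).

Definition bmatrix (c : forall i j, hom (F i) (G j)) : hom B D :=
  bcopair B (fun i => bpair D (c i)).

Definition bmap (g : forall i, hom (F i) (G i)) : hom B D :=
  bcopair B (fun i => binj D i ∘ g i).

Lemma bmatrixE (c : forall i j, hom (F i) (G j)) i j :
  bprj D j ∘ bmatrix c ∘ binj B i = c i j.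
Proof. by rewrite -compA bcopairE bpairE. Qed.

Lemma bmap_inj (g : forall i, hom (F i) (G i)) i :
  bmap g ∘ binj B i = binj D i ∘ g i.
Proof. exact: bcopairE. Qed.

Lemma bprj_map (g : forall i, hom (F i) (G i)) j :
  bprj D j ∘ bmap g = g j ∘ bprj B j.
Proof.
apply: bip_ext_in => i.
rewrite -!compA bmap_inj [LHS]compA !bprj_inj at_index_comp comp_at_index.
by rewrite comp1m compm1.
Qed.
End Matrix.
Arguments bmatrix {C F G} B D c.
Arguments bmap {C F G} B D g.

Lemma bmap_id (C : preadditive) (F : nat -> C) (B : biproduct F) :
  bmap B B (fun i => idm (F i)) = idm (bip_ob B).
Proof. by apply: bip_ext_in => i; rewrite bmap_inj compm1 comp1m. Qed.

Lemma bmap_comp (C : preadditive) (F G H : nat -> C) (B : biproduct F)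
    (D : biproduct G) (E : biproduct H) (h : forall i, hom (G i) (H i))
    (g : forall i, hom (F i) (G i)) :
  bmap B E (fun i => h i ∘ g i) = bmap D E h ∘ bmap B D g.
Proof.
by apply: bip_ext_in => i; rewrite -compA !bmap_inj !compA bmap_inj.
Qed.

(* The identification X^i(X(N)) = X^{i+1}(N) = X(X^i(N)), in both directions;
   the two sides are equal but, for a variable i, not convertible. *)
Fixpoint pow_shift (C : category) (X : functor C C) (N : C) (i : nat) :
    hom (fpow X i (X N)) (fpow X i.+1 N) :=
  if i is k.+1 then
    @fmap _ _ X (fpow X k (X N)) (fpow X k.+1 N) (pow_shift X N k)
  else idm (X N).

Fixpoint pow_unshift (C : category) (X : functor C C) (N : C) (i : nat) :
    hom (fpow X i.+1 N) (fpow X i (X N)) :=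
  if i is k.+1 then
    @fmap _ _ X (fpow X k.+1 N) (fpow X k (X N)) (pow_unshift X N k)
  else idm (X N).

Section PowShiftTheory.
Variables (C : category) (X : functor C C).

Lemma pow_shift_ob (N : C) i : fpow X i (X N) = fpow X i.+1 N.
Proof. by elim: i => //= i ->. Qed.

Lemma pow_shiftE (N : C) i :
  pow_shift X N i
  = eq_rect _ (hom (fpow X i (X N))) (idm _) _ (pow_shift_ob N i).
Proof.
elim: i => [|i IH].
  by rewrite (Prop_irrelevance (pow_shift_ob N 0) erefl).
rewrite /= IH; move: (pow_shift_ob N i) (pow_shift_ob N i.+1) => /=.
case: _ / => e; rewrite (Prop_irrelevance e erefl) /=; exact: fmap1.
Qed.

Lemma pow_shiftK (N : C) i : pow_unshift X N i ∘ pow_shift X N i = idm _.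
Proof. by elim: i => [|i IH] /=; rewrite ?comp1m // -fmapM IH fmap1. Qed.

Lemma pow_unshiftK (N : C) i : pow_shift X N i ∘ pow_unshift X N i = idm _.
Proof. by elim: i => [|i IH] /=; rewrite ?comp1m // -fmapM IH fmap1. Qed.

Lemma pow_shift_nat (M N : C) (a : hom M N) i :
  pow_shift X N i ∘ fmap (fpow X i) (fmap X a)
  = fmap (fpow X i.+1) a ∘ pow_shift X M i.
Proof.
by elim: i => [|i IH] /=; [rewrite comp1m compm1 | rewrite -!fmapM IH].
Qed.

Lemma pow_unshift_nat (M N : C) (a : hom M N) i :
  pow_unshift X N i ∘ fmap (fpow X i.+1) a
  = fmap (fpow X i) (fmap X a) ∘ pow_unshift X M i.
Proof.
by elim: i => [|i IH] /=; [rewrite comp1m compm1 | rewrite -!fmapM IH].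
Qed.
End PowShiftTheory.

Section AdjunctionTheory.
Variables (C D : preadditive) (F : functor C D) (G : functor D C).
Variable adj : adjunction F G.

Definition transpose (M : C) (N : D) (h : hom (F M) N) : hom M (G N) :=
  locked (fmap G h ∘ unit adj M).

Definition untranspose (M : C) (N : D) (k : hom M (G N)) : hom (F M) N :=
  locked (counit adj N ∘ fmap F k).

Lemma transposeK (M : C) (N : D) (h : hom (F M) N) :
  untranspose (transpose h) = h.
Proof.
rewrite /untranspose /transpose -!lock fmapM compA counit_nat -compA.
by rewrite triangleF compm1.
Qed.

Lemma untransposeK (M : C) (N : D) (k : hom M (G N)) :
  transpose (untranspose k) = k.
Proof.
rewrite /untranspose /transpose -!lock fmapM -compA unit_nat compA.
by rewrite triangleG comp1m.
Qed.

Lemma transpose_pre (M M' : C) (N : D) (h : hom (F M) N) (a : hom M' M) :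
  transpose (h ∘ fmap F a) = transpose h ∘ a.
Proof. by rewrite /transpose -!lock fmapM -!compA unit_nat. Qed.

Lemma transpose_post (M : C) (N N' : D) (b : hom N N') (h : hom (F M) N) :
  transpose (b ∘ h) = fmap G b ∘ transpose h.
Proof. by rewrite /transpose -!lock fmapM compA. Qed.

Lemma untranspose_pre (M M' : C) (N : D) (k : hom M (G N)) (a : hom M' M) :
  untranspose (k ∘ a) = untranspose k ∘ fmap F a.
Proof. by rewrite /untranspose -!lock fmapM compA. Qed.

Lemma untranspose_post (M : C) (N N' : D) (b : hom N N') (k : hom M (G N)) :
  untranspose (fmap G b ∘ k) = b ∘ untranspose k.
Proof. by rewrite /untranspose -!lock fmapM !compA counit_nat. Qed.

Lemma ladj_ext_in (H : nat -> C) (B : biproduct H) (N : D)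
    (u v : hom (F B) N) :
  (forall i, u ∘ fmap F (binj B i) = v ∘ fmap F (binj B i)) -> u = v.
Proof.
move=> uv; rewrite -(transposeK u) -(transposeK v); congr untranspose.
by apply: bip_ext_in => i; rewrite -!transpose_pre uv.
Qed.

Lemma radj_ext_out (H : nat -> D) (B : biproduct H) (L : C)
    (u v : hom L (G B)) :
  (forall j, fmap G (bprj B j) ∘ u = fmap G (bprj B j) ∘ v) -> u = v.
Proof.
move=> uv; rewrite -(untransposeK u) -(untransposeK v); congr transpose.
by apply: bip_ext_out => i; rewrite -!untranspose_post uv.
Qed.
End AdjunctionTheory.

(* For an endofunctor T of a category C, the category of pairs (M, T M -> M).
   It is used both as the Eilenberg-Moore category of the free monad on X, for
   T := X, and as the category (tau^- ⇓ Id), for T := tau^-. *)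
Section Algebras.
Variables (C : category) (T : functor C C).

#[projections(primitive)]
Record alg := Alg { alg_ob : C; alg_str : hom (T alg_ob) alg_ob }.

Record alg_hom (A B : alg) := AlgHom {
  alg_map : hom (alg_ob A) (alg_ob B);
  alg_mapP : alg_map ∘ alg_str A = alg_str B ∘ fmap T alg_map
}.

Lemma alg_hom_eq (A B : alg) (f g : alg_hom A B) :
  alg_map f = alg_map g -> f = g.
Proof.
case: f g => f fP [g gP] /= fg; case: _ / fg gP => gP.
by rewrite (Prop_irrelevance fP gP).
Qed.

Fact alg_id_subproof (A : alg) :
  idm (alg_ob A) ∘ alg_str A = alg_str A ∘ fmap T (idm (alg_ob A)).
Proof. by rewrite fmap1 comp1m compm1. Qed.
Definition alg_id A : alg_hom A A := AlgHom (alg_id_subproof A).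

Fact alg_comp_subproof (A B D : alg) (g : alg_hom B D) (f : alg_hom A B) :
  (alg_map g ∘ alg_map f) ∘ alg_str A
  = alg_str D ∘ fmap T (alg_map g ∘ alg_map f).
Proof. by rewrite fmapM -compA alg_mapP compA alg_mapP compA. Qed.
Definition alg_comp A B D g f : alg_hom A D :=
  AlgHom (@alg_comp_subproof A B D g f).

Fact alg_comp1m A B (f : alg_hom A B) : alg_comp (alg_id B) f = f.
Proof. by apply: alg_hom_eq; apply: comp1m. Qed.
Fact alg_compm1 A B (f : alg_hom A B) : alg_comp f (alg_id A) = f.
Proof. by apply: alg_hom_eq; apply: compm1. Qed.
Fact alg_compA A B D E (h : alg_hom D E) (g : alg_hom B D) (f : alg_hom A B) :
  alg_comp h (alg_comp g f) = alg_comp (alg_comp h g) f.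
Proof. by apply: alg_hom_eq; apply: compA. Qed.

Definition alg_cat : category := Category alg_comp1m alg_compm1 alg_compA.

Definition alg_forget : functor alg_cat C :=
  @Functor alg_cat C alg_ob (fun A B (f : alg_hom A B) => alg_map f)
    (fun=> erefl) (fun _ _ _ _ _ => erefl).
End Algebras.

(* The category (Id ⇓ T) of pairs (M, M -> T M), for an endofunctor T. *)
Section Coalgebras.
Variables (C : category) (T : functor C C).

#[projections(primitive)]
Record coalg := Coalg { coalg_ob : C; coalg_str : hom coalg_ob (T coalg_ob) }.

Record coalg_hom (A B : coalg) := CoalgHom {
  coalg_map : hom (coalg_ob A) (coalg_ob B);
  coalg_mapP : coalg_str B ∘ coalg_map = fmap T coalg_map ∘ coalg_str A
}.

Lemma coalg_hom_eq (A B : coalg) (f g : coalg_hom A B) :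
  coalg_map f = coalg_map g -> f = g.
Proof.
case: f g => f fP [g gP] /= fg; case: _ / fg gP => gP.
by rewrite (Prop_irrelevance fP gP).
Qed.

Fact coalg_id_subproof (A : coalg) :
  coalg_str A ∘ idm (coalg_ob A) = fmap T (idm (coalg_ob A)) ∘ coalg_str A.
Proof. by rewrite fmap1 comp1m compm1. Qed.
Definition coalg_id A : coalg_hom A A := CoalgHom (coalg_id_subproof A).

Fact coalg_comp_subproof (A B D : coalg) (g : coalg_hom B D)
    (f : coalg_hom A B) :
  coalg_str D ∘ (coalg_map g ∘ coalg_map f)
  = fmap T (coalg_map g ∘ coalg_map f) ∘ coalg_str A.
Proof. by rewrite fmapM compA coalg_mapP -compA coalg_mapP compA. Qed.
Definition coalg_comp A B D g f : coalg_hom A D :=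
  CoalgHom (@coalg_comp_subproof A B D g f).

Fact coalg_comp1m A B (f : coalg_hom A B) : coalg_comp (coalg_id B) f = f.
Proof. by apply: coalg_hom_eq; apply: comp1m. Qed.
Fact coalg_compm1 A B (f : coalg_hom A B) : coalg_comp f (coalg_id A) = f.
Proof. by apply: coalg_hom_eq; apply: compm1. Qed.
Fact coalg_compA A B D E (h : coalg_hom D E) (g : coalg_hom B D)
    (f : coalg_hom A B) :
  coalg_comp h (coalg_comp g f) = coalg_comp (coalg_comp h g) f.
Proof. by apply: coalg_hom_eq; apply: compA. Qed.

Definition coalg_cat : category :=
  Category coalg_comp1m coalg_compm1 coalg_compA.

Definition coalg_forget : functor coalg_cat C :=
  @Functor coalg_cat C coalg_ob (fun A B (f : coalg_hom A B) => coalg_map f)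
    (fun=> erefl) (fun _ _ _ _ _ => erefl).
End Coalgebras.

Section AlgebrasPreadditive.
Variables (C : preadditive) (X : addfunctor C C).

HB.instance Definition _ (A B : alg X) := gen_eqMixin (alg_hom A B).
HB.instance Definition _ (A B : alg X) := gen_choiceMixin (alg_hom A B).

Section Group.
Variables A B : alg X.
Implicit Types f g : alg_hom A B.

Fact alg_zero_subproof :
  (0 : hom (alg_ob A) (alg_ob B)) ∘ alg_str A = alg_str B ∘ fmap X 0.
Proof. by rewrite fmap0 comp0m compm0. Qed.
Definition alg_zero : alg_hom A B := AlgHom alg_zero_subproof.

Fact alg_opp_subproof f :
  (- alg_map f) ∘ alg_str A = alg_str B ∘ fmap X (- alg_map f).
Proof. by rewrite fmapN compNm compmN alg_mapP. Qed.
Definition alg_opp f : alg_hom A B := AlgHom (alg_opp_subproof f).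

Fact alg_add_subproof f g :
  (alg_map f + alg_map g) ∘ alg_str A
  = alg_str B ∘ fmap X (alg_map f + alg_map g).
Proof. by rewrite fmapD compDl compDr !alg_mapP. Qed.
Definition alg_add f g : alg_hom A B := AlgHom (alg_add_subproof f g).

Fact alg_addA : associative alg_add.
Proof. by move=> f g h; apply: alg_hom_eq; apply: addrA. Qed.
Fact alg_addC : commutative alg_add.
Proof. by move=> f g; apply: alg_hom_eq; apply: addrC. Qed.
Fact alg_add0 : left_id alg_zero alg_add.
Proof. by move=> f; apply: alg_hom_eq; apply: add0r. Qed.
Fact alg_addN : left_inverse alg_zero alg_opp alg_add.
Proof. by move=> f; apply: alg_hom_eq; apply: addNr. Qed.

HB.instance Definition _ :=
  GRing.isZmodule.Build (alg_hom A B) alg_addA alg_addC alg_add0 alg_addN.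
End Group.

Canonical alg_pz : precategory_Z :=
  @PrecategoryZ (alg_cat X)
    (fun A B => GRing.Zmodule.class (alg_hom A B : zmodType)).

Fact alg_compDl (A B D : alg_pz) (g g' : hom B D) (f : hom A B) :
  (g + g') ∘ f = g ∘ f + g' ∘ f.
Proof. by apply: alg_hom_eq; apply: compDl. Qed.
Fact alg_compDr (A B D : alg_pz) (g : hom B D) (f f' : hom A B) :
  g ∘ (f + f') = g ∘ f + g ∘ f'.
Proof. by apply: alg_hom_eq; apply: compDr. Qed.

Canonical alg_preadd : preadditive := Preadditive alg_compDl alg_compDr.
End AlgebrasPreadditive.

(* Kernels and cokernels exist in the category of X-algebras, so that the
   choices of kernels and cokernels on which tau and taum depend exist. *)
Lemma alg_has_kernels (C : preadditive) (X : addfunctor C C) :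
  is_abelian C ->
  forall (A B : alg_preadd X) (f : hom A B), inhabited (kernel f).
Proof.
move=> abC A B f.
have [K [k kP]] := ab_ker abC (alg_map f).
pose kk := Kernel kP.
have h0 : alg_map f ∘ (alg_str A ∘ fmap X k) = 0.
  by rewrite compA alg_mapP -compA -fmapM kP.1 fmap0 compm0.
pose KA : alg_preadd X := @Alg C X K (ker_lift kk h0).
have kh : k ∘ alg_str KA = alg_str A ∘ fmap X k by exact: (ker_liftE kk).
pose ka : hom KA A := @AlgHom C X KA A k kh.
split; apply: (@Kernel _ _ _ f KA ka); split.
  by apply: alg_hom_eq; exact: kP.1.
move=> L g fg0.
have fg0' : alg_map f ∘ alg_map g = 0 by exact: (congr1 (@alg_map _ _ _ _) fg0).
have uE := ker_liftE kk fg0'; set u := ker_lift kk fg0' in uE.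
have uh : u ∘ alg_str L = alg_str KA ∘ fmap X u.
  apply: (ker_mono (K := kk)).
  by rewrite /= !compA kh uE alg_mapP -compA -fmapM uE.
exists (@AlgHom C X L KA u uh); split; first exact: alg_hom_eq.
move=> v vE; apply: alg_hom_eq; apply: (ker_mono (K := kk)).
rewrite [LHS]uE; exact: (esym (congr1 (@alg_map _ _ _ _) vE)).
Qed.

Lemma alg_has_cokernels (C : preadditive) (X Y : addfunctor C C)
    (XY : adjunction X Y) :
  is_abelian C ->
  forall (A B : alg_preadd X) (f : hom A B), inhabited (cokernel f).
Proof.
move=> abC A B f.
have [Q [q qP]] := ab_coker abC (alg_map f).
pose qq := Cokernel qP.
have h0 : transpose XY (q ∘ alg_str B) ∘ alg_map f = 0.
  rewrite -transpose_pre -compA -alg_mapP compA qP.1 comp0m.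
  by rewrite /transpose -!lock fmap0 comp0m.
pose QA : alg_preadd X := @Alg C X Q (untranspose XY (coker_desc qq h0)).
have qh : q ∘ alg_str B = alg_str QA ∘ fmap X q.
  by rewrite /= -untranspose_pre (coker_descE qq) transposeK.
pose qa : hom B QA := @AlgHom C X B QA q qh.
have Xepi : is_epi (fmap X q).
  move=> P u v uv; rewrite -(transposeK XY u) -(transposeK XY v).
  congr untranspose; apply: (coker_epi (Q := qq)).
  by rewrite -!transpose_pre uv.
split; apply: (@Cokernel _ _ _ f QA qa); split.
  by apply: alg_hom_eq; exact: qP.1.
move=> L g gf0.
have gf0' : alg_map g ∘ alg_map f = 0 by exact: (congr1 (@alg_map _ _ _ _) gf0).
have uE := coker_descE qq gf0'; set u := coker_desc qq gf0' in uE.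
have uh : u ∘ alg_str QA = alg_str L ∘ fmap X u.
  apply: Xepi.
  by rewrite -!compA -qh -fmapM compA uE alg_mapP.
exists (@AlgHom C X QA L u uh); split; first exact: alg_hom_eq.
move=> v vE; apply: alg_hom_eq; apply: (coker_epi (Q := qq)).
rewrite [LHS]uE; exact: (esym (congr1 (@alg_map _ _ _ _) vE)).
Qed.

(* fshriek and fstar are the functors f_! and f_*, the left and right adjoints
   of the forgetful functor f^* from X-algebras to C; taum is tau^-.  As limits
   and colimits are determined only up to isomorphism, these functors take as
   arguments the chosen biproducts BX and BY of the X^i M and of the Y^i M, and
   the chosen kernels K and cokernels Q. *)
Section FreeCofree.
Variables (C : preadditive) (X Y : addfunctor C C).
Variables (XY : adjunction X Y) (YX : adjunction Y X).
Variable BX : forall M : C, biproduct (fun i => fpow X i M).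
Variable BY : forall M : C, biproduct (fun i => fpow Y i M).

Notation A_ := (alg_preadd X).

(* The adjoint h_1^♭ : M -> Y M of the structure map h_1 : X M -> M. *)
Definition flat (A : alg X) : hom (alg_ob A) (Y (alg_ob A)) :=
  transpose XY (alg_str A).

Lemma flat_hom (A B : alg X) (a : hom (alg_ob A) (alg_ob B)) :
  flat B ∘ a = fmap Y a ∘ flat A -> a ∘ alg_str A = alg_str B ∘ fmap X a.
Proof.
move=> ha; rewrite -[LHS](transposeK XY) -[RHS](transposeK XY).
congr untranspose.
by rewrite transpose_pre transpose_post.
Qed.

Lemma hom_flat (A B : A_) (a : hom A B) :
  flat B ∘ alg_map a = fmap Y (alg_map a) ∘ flat A.
Proof. by rewrite -transpose_pre -alg_mapP transpose_post. Qed.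

(* The inclusion of X(⨁_i X^i M) = ⨁_{i >= 1} X^i M into ⨁_i X^i M, given by
   its components; see [fshriek_str_inj]. *)
Definition fshriek_str (M : C) : hom (X (BX M)) (BX M) :=
  bpair (BX M) (fun j => if j is k.+1 then
    @fmap _ _ X (BX M) (fpow X k M) (bprj (BX M) k) else 0).

Lemma fshriek_str_prj0 M : bprj (BX M) 0 ∘ fshriek_str M = 0.
Proof. exact: (bpairE (BX M) _ 0). Qed.

Lemma fshriek_str_prjS M k :
  bprj (BX M) k.+1 ∘ fshriek_str M
  = @fmap _ _ X (BX M) (fpow X k M) (bprj (BX M) k).
Proof. exact: (bpairE (BX M) _ k.+1). Qed.

Lemma fshriek_str_inj M i :
  fshriek_str M ∘ fmap X (binj (BX M) i) = binj (BX M) i.+1.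
Proof.
apply: bip_ext_out => -[|j]; rewrite compA.
  by rewrite fshriek_str_prj0 comp0m (bprj_inj (BX M) i.+1 0) at_index_neq.
rewrite fshriek_str_prjS -(fmapM X (bprj (BX M) j) (binj (BX M) i)).
rewrite (bprj_inj (BX M) i j) (bprj_inj (BX M) i.+1 j.+1).
by rewrite -fmap_at_index fmap1; apply: erefl.
Qed.

Definition fshriek_ob (M : C) : alg X := @Alg C X (BX M) (fshriek_str M).

Definition fshriek_map (M N : C) (a : hom M N) : hom (BX M) (BX N) :=
  bmap (BX M) (BX N) (fun i => fmap (fpow X i) a).

Lemma fshriek_map_inj (M N : C) (a : hom M N) i :
  fshriek_map a ∘ binj (BX M) i = binj (BX N) i ∘ fmap (fpow X i) a.
Proof. exact: bmap_inj. Qed.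

Lemma fshriek_map_prj (M N : C) (a : hom M N) j :
  bprj (BX N) j ∘ fshriek_map a = fmap (fpow X j) a ∘ bprj (BX M) j.
Proof. exact: (bprj_map _ _ (fun i => fmap (fpow X i) a)). Qed.

Fact fshriek_map_subproof (M N : C) (a : hom M N) :
  fshriek_map a ∘ fshriek_str M = fshriek_str N ∘ fmap X (fshriek_map a).
Proof.
apply: (ladj_ext_in XY) => i.
rewrite -!compA fshriek_str_inj -fmapM !fshriek_map_inj fmapM compA.
rewrite fshriek_str_inj; exact: (fshriek_map_inj a i.+1).
Qed.

Definition fshriek_hom (M N : C) (a : hom M N) :
    alg_hom (fshriek_ob M) (fshriek_ob N) :=
  @AlgHom C X (fshriek_ob M) (fshriek_ob N) (fshriek_map a)
    (fshriek_map_subproof a).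

Fact fshriek1 (M : C) :
  fshriek_hom (idm M) = idm (fshriek_ob M : alg_cat X).
Proof.
apply: alg_hom_eq => /=; rewrite -bmap_id; congr bmap.
by apply: functional_extensionality_dep => i; rewrite fmap1.
Qed.

Fact fshriekM (M N P : C) (b : hom N P) (a : hom M N) :
  fshriek_hom (b ∘ a) = (fshriek_hom b : hom (fshriek_ob N : alg_cat X) _)
                        ∘ (fshriek_hom a : hom (fshriek_ob M : alg_cat X) _).
Proof.
apply: alg_hom_eq => /=; rewrite -bmap_comp; congr bmap.
by apply: functional_extensionality_dep => i; rewrite fmapM.
Qed.

Definition fshriek : functor C (alg_cat X) :=
  @Functor C (alg_cat X) fshriek_ob fshriek_hom fshriek1 fshriekM.

(* The projection of ⨁_i Y^i M onto ⨁_{i >= 1} Y^i M = Y(⨁_i Y^i M), given by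
   its components; see [fstar_flat_prj]. *)
Definition fstar_flat (M : C) : hom (BY M) (Y (BY M)) :=
  bcopair (BY M) (fun i => if i is k.+1 then
    @fmap _ _ Y (fpow Y k M) (BY M) (binj (BY M) k) else 0).

Lemma fstar_flat_inj0 M : fstar_flat M ∘ binj (BY M) 0 = 0.
Proof. exact: (bcopairE (BY M) _ 0). Qed.

Lemma fstar_flat_injS M k :
  fstar_flat M ∘ binj (BY M) k.+1
  = @fmap _ _ Y (fpow Y k M) (BY M) (binj (BY M) k).
Proof. exact: (bcopairE (BY M) _ k.+1). Qed.

Lemma fstar_flat_prj M j :
  fmap Y (bprj (BY M) j) ∘ fstar_flat M = bprj (BY M) j.+1.
Proof.
apply: bip_ext_in => -[|i]; rewrite -compA.
  by rewrite fstar_flat_inj0 compm0 (bprj_inj (BY M) 0 j.+1) at_index_neq.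
rewrite fstar_flat_injS -(fmapM Y (bprj (BY M) j) (binj (BY M) i)).
rewrite (bprj_inj (BY M) i j) (bprj_inj (BY M) i.+1 j.+1).
by rewrite -fmap_at_index fmap1; apply: erefl.
Qed.

Definition fstar_ob (M : C) : alg X :=
  @Alg C X (BY M) (untranspose XY (fstar_flat M)).

Lemma flat_fstar M : flat (fstar_ob M) = fstar_flat M.
Proof. exact: untransposeK. Qed.

Definition fstar_map (M N : C) (a : hom M N) : hom (BY M) (BY N) :=
  bmap (BY M) (BY N) (fun i => fmap (fpow Y i) a).

Lemma fstar_map_inj (M N : C) (a : hom M N) i :
  fstar_map a ∘ binj (BY M) i = binj (BY N) i ∘ fmap (fpow Y i) a.
Proof. exact: bmap_inj. Qed.

Lemma fstar_map_prj (M N : C) (a : hom M N) j :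
  bprj (BY N) j ∘ fstar_map a = fmap (fpow Y j) a ∘ bprj (BY M) j.
Proof. exact: (bprj_map _ _ (fun i => fmap (fpow Y i) a)). Qed.

Fact fstar_map_subproof (M N : C) (a : hom M N) :
  fstar_map a ∘ alg_str (fstar_ob M)
  = alg_str (fstar_ob N) ∘ fmap X (fstar_map a).
Proof.
apply: (@flat_hom (fstar_ob M) (fstar_ob N) (fstar_map a)); rewrite !flat_fstar.
apply: (radj_ext_out XY) => j.
rewrite !compA fstar_flat_prj -fmapM !fstar_map_prj fmapM -!compA.
rewrite fstar_flat_prj; exact: (fstar_map_prj a j.+1).
Qed.

Definition fstar_hom (M N : C) (a : hom M N) :
    alg_hom (fstar_ob M) (fstar_ob N) :=
  @AlgHom C X (fstar_ob M) (fstar_ob N) (fstar_map a) (fstar_map_subproof a).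

Fact fstar1 (M : C) : fstar_hom (idm M) = idm (fstar_ob M : alg_cat X).
Proof.
apply: alg_hom_eq => /=; rewrite -bmap_id; congr bmap.
by apply: functional_extensionality_dep => i; rewrite fmap1.
Qed.

Fact fstarM (M N P : C) (b : hom N P) (a : hom M N) :
  fstar_hom (b ∘ a) = (fstar_hom b : hom (fstar_ob N : alg_cat X) _)
                      ∘ (fstar_hom a : hom (fstar_ob M : alg_cat X) _).
Proof.
apply: alg_hom_eq => /=; rewrite -bmap_comp; congr bmap.
by apply: functional_extensionality_dep => i; rewrite fmapM.
Qed.

Definition fstar : functor C (alg_cat X) :=
  @Functor C (alg_cat X) fstar_ob fstar_hom fstar1 fstarM.

Section Chi.
Variable A : alg X.
Let M := alg_ob A.

(* The components Y^i X M -> Y^j M: -Y^i(h_1) if j = i, Y^{i-1} of the counit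
   if j = i - 1, and 0 otherwise. *)
Definition chi_comp (i j : nat) : hom (fpow Y i (X M)) (fpow Y j M) :=
  at_index (G := fun j => fpow Y j M) i (- fmap (fpow Y i) (alg_str A)) j
  + (if i is k.+1 return hom (fpow Y i (X M)) (fpow Y j M) then
       at_index (G := fun j => fpow Y j M) k
         (fmap (fpow Y k) (counit YX M) ∘ pow_unshift Y (X M) k) j
     else 0).

Lemma chi_comp0S j : chi_comp 0 j.+1 = 0.
Proof. by rewrite /chi_comp at_index_neq // addr0. Qed.

Lemma chi_compSS i j : chi_comp i.+1 j.+1
  = @fmap _ _ Y (fpow Y i (X M)) (fpow Y j M) (chi_comp i j).
Proof.
rewrite /chi_comp fmapD -fmap_at_index fmapN; congr (_ + _).
case: i => [|i]; first by rewrite at_index_neq // fmap0.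
by rewrite -fmap_at_index fmapM.
Qed.

Definition chi_map : hom (BY (X M)) (BY M) := bmatrix _ _ chi_comp.

Lemma chi_mapE i j :
  bprj (BY M) j ∘ chi_map ∘ binj (BY (X M)) i = chi_comp i j.
Proof. exact: (bmatrixE _ _ chi_comp). Qed.

Fact chi_subproof :
  chi_map ∘ alg_str (fstar_ob (X M)) = alg_str (fstar_ob M) ∘ fmap X chi_map.
Proof.
apply: (@flat_hom (fstar_ob (X M)) (fstar_ob M) chi_map); rewrite !flat_fstar.
apply: bip_ext_in => i; apply: (radj_ext_out XY) => j.
rewrite !compA fstar_flat_prj (chi_mapE i j.+1) -fmapM -compA.
case: i => [|i]; first by rewrite fstar_flat_inj0 compm0 chi_comp0S.
rewrite fstar_flat_injS -(fmapM Y (bprj (BY M) j ∘ chi_map) (binj _ i)).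
by rewrite chi_mapE chi_compSS.
Qed.

Definition chi : hom (fstar (X M) : A_) (fstar M : A_) :=
  @AlgHom C X (fstar_ob (X M)) (fstar_ob M) chi_map chi_subproof.
End Chi.

Lemma chi_nat (A B : A_) (a : hom A B) :
  chi B ∘ fmap fstar (fmap X (alg_map a)) = fmap fstar (alg_map a) ∘ chi A.
Proof.
apply: alg_hom_eq; apply: bip_ext_in => i; apply: bip_ext_out => j /=.
rewrite -!compA bmap_inj !compA bmatrixE bprj_map -compA -compA.
rewrite [bprj _ _ ∘ _]compA bmatrixE /chi_comp compDl compDr.
rewrite at_index_comp (comp_at_index _ (fun j => fmap (fpow Y j) (alg_map a))).
rewrite compNm compmN -!fmapM alg_mapP; congr (_ + _).
case: i => [|i]; first by rewrite comp0m compm0.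
rewrite at_index_comp (comp_at_index _ (fun j => fmap (fpow Y j) (alg_map a))).
by rewrite -compA pow_unshift_nat !compA -!fmapM counit_nat.
Qed.

Section Tau.
Variable K : forall A : A_, kernel (chi A).

Fact tau_map_subproof (A B : A_) (a : hom A B) :
  chi B ∘ (fmap fstar (fmap X (alg_map a)) ∘ ker_mor (K A)) = 0.
Proof. by rewrite compA chi_nat -compA ker_comp0 compm0. Qed.

Definition tau_map (A B : A_) (a : hom A B) :
    hom (ker_ob (K A)) (ker_ob (K B)) :=
  ker_lift (K B) (tau_map_subproof a).

Lemma tau_mapE (A B : A_) (a : hom A B) :
  ker_mor (K B) ∘ tau_map a = fmap fstar (fmap X (alg_map a)) ∘ ker_mor (K A).
Proof. exact: ker_liftE. Qed.

Fact tau1 (A : A_) : tau_map (idm A) = idm (ker_ob (K A)).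
Proof.
by apply: (ker_mono (K := K A)); rewrite tau_mapE compm1 !fmap1 comp1m.
Qed.

Fact tauM (A B D : A_) (b : hom B D) (a : hom A B) :
  tau_map (b ∘ a) = tau_map b ∘ tau_map a.
Proof.
apply: (ker_mono (K := K D)).
by rewrite compA !tau_mapE -compA tau_mapE !fmapM compA.
Qed.

Definition tau : functor (alg_cat X) (alg_cat X) :=
  @Functor (alg_cat X) (alg_cat X) (fun A => ker_ob (K A)) tau_map tau1 tauM.
End Tau.

Section Chim.
Variable A : alg X.
Let M := alg_ob A.

(* The components X^i M -> X^j Y M: -X^i(h_1^♭) if j = i, X^i of the unit if
   j = i + 1, and 0 otherwise. *)
Definition chim_comp (i j : nat) : hom (fpow X i M) (fpow X j (Y M)) :=
  at_index (G := fun j => fpow X j (Y M)) i (- fmap (fpow X i) (flat A)) j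
  + at_index (G := fun j => fpow X j (Y M)) i.+1
      (pow_shift X (Y M) i ∘ fmap (fpow X i) (unit YX M)) j.

Lemma chim_compS0 i : chim_comp i.+1 0 = 0.
Proof. by rewrite /chim_comp !at_index_neq // addr0. Qed.

Lemma chim_compSS i j : chim_comp i.+1 j.+1
  = @fmap _ _ X (fpow X i M) (fpow X j (Y M)) (chim_comp i j).
Proof. by rewrite /chim_comp fmapD -!fmap_at_index fmapN fmapM. Qed.

Definition chim_map : hom (BX M) (BX (Y M)) := bmatrix _ _ chim_comp.

Lemma chim_mapE i j :
  bprj (BX (Y M)) j ∘ chim_map ∘ binj (BX M) i = chim_comp i j.
Proof. exact: (bmatrixE _ _ chim_comp). Qed.

Fact chim_subproof :
  chim_map ∘ alg_str (fshriek_ob M)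
  = alg_str (fshriek_ob (Y M)) ∘ fmap X chim_map.
Proof.
apply: (ladj_ext_in XY) => i; apply: bip_ext_out => j /=.
rewrite -!compA fshriek_str_inj -fmapM compA (chim_mapE i.+1 j) compA.
case: j => [|j]; first by rewrite fshriek_str_prj0 comp0m chim_compS0.
rewrite fshriek_str_prjS -(fmapM X (bprj _ j) (chim_map ∘ binj (BX M) i)) compA.
by rewrite chim_mapE chim_compSS.
Qed.

Definition chim : hom (fshriek M : A_) (fshriek (Y M) : A_) :=
  @AlgHom C X (fshriek_ob M) (fshriek_ob (Y M)) chim_map chim_subproof.
End Chim.

Lemma chim_nat (A B : A_) (a : hom A B) :
  fmap fshriek (fmap Y (alg_map a)) ∘ chim A
  = chim B ∘ fmap fshriek (alg_map a).
Proof.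
apply: alg_hom_eq; apply: bip_ext_in => i; apply: bip_ext_out => j /=.
rewrite -!compA bmap_inj !compA bmatrixE bprj_map -compA -compA.
rewrite [bprj _ _ ∘ _]compA bmatrixE /chim_comp compDl compDr.
rewrite !at_index_comp.
rewrite !(comp_at_index _ (fun j => fmap (fpow X j) (fmap Y (alg_map a)))).
rewrite compNm compmN -!fmapM hom_flat -[in RHS]compA -fmapM -unit_nat.
by rewrite (fmapM _ (fmap X _)) !compA pow_shift_nat.
Qed.

Section Taum.
Variable Q : forall A : A_, cokernel (chim A).

Fact taum_map_subproof (A B : A_) (a : hom A B) :
  (coker_mor (Q B) ∘ fmap fshriek (fmap Y (alg_map a))) ∘ chim A = 0.
Proof. by rewrite -compA chim_nat compA coker_comp0 comp0m. Qed.

Definition taum_map (A B : A_) (a : hom A B) :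
    hom (coker_ob (Q A)) (coker_ob (Q B)) :=
  coker_desc (Q A) (taum_map_subproof a).

Lemma taum_mapE (A B : A_) (a : hom A B) :
  taum_map a ∘ coker_mor (Q A)
  = coker_mor (Q B) ∘ fmap fshriek (fmap Y (alg_map a)).
Proof. exact: coker_descE. Qed.

Fact taum1 (A : A_) : taum_map (idm A) = idm (coker_ob (Q A)).
Proof.
by apply: (coker_epi (Q := Q A)); rewrite taum_mapE comp1m !fmap1 compm1.
Qed.

Fact taumM (A B D : A_) (b : hom B D) (a : hom A B) :
  taum_map (b ∘ a) = taum_map b ∘ taum_map a.
Proof.
apply: (coker_epi (Q := Q A)).
by rewrite -compA !taum_mapE compA taum_mapE !fmapM compA.
Qed.

Definition taum : functor (alg_cat X) (alg_cat X) :=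
  @Functor (alg_cat X) (alg_cat X) (fun A => coker_ob (Q A))
    taum_map taum1 taumM.
End Taum.
End FreeCofree.

(* The category C^Pi(X). *)
Section PiAlgebras.
Variables (C : category) (X Y : functor C C).
Variables (XY : adjunction X Y) (YX : adjunction Y X).

#[projections(primitive)]
Record pi_alg := PiAlg {
  pi_ob : C;
  pi_strX : hom (X pi_ob) pi_ob;
  pi_strY : hom (Y pi_ob) pi_ob;
  pi_rel : pi_strY ∘ fmap Y pi_strX ∘ unit XY pi_ob
           = pi_strX ∘ fmap X pi_strY ∘ unit YX pi_ob
}.

Record pi_hom (A B : pi_alg) := PiHom {
  pi_map : hom (pi_ob A) (pi_ob B);
  pi_mapX : pi_map ∘ pi_strX A = pi_strX B ∘ fmap X pi_map;
  pi_mapY : pi_map ∘ pi_strY A = pi_strY B ∘ fmap Y pi_map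
}.

Lemma pi_hom_eq (A B : pi_alg) (f g : pi_hom A B) :
  pi_map f = pi_map g -> f = g.
Proof.
case: f g => f fX fY [g gX gY] /= fg; case: _ / fg gX gY => gX gY.
by rewrite (Prop_irrelevance fX gX) (Prop_irrelevance fY gY).
Qed.

Fact pi_idX (A : pi_alg) :
  idm (pi_ob A) ∘ pi_strX A = pi_strX A ∘ fmap X (idm (pi_ob A)).
Proof. by rewrite fmap1 comp1m compm1. Qed.
Fact pi_idY (A : pi_alg) :
  idm (pi_ob A) ∘ pi_strY A = pi_strY A ∘ fmap Y (idm (pi_ob A)).
Proof. by rewrite fmap1 comp1m compm1. Qed.
Definition pi_id A : pi_hom A A := PiHom (pi_idX A) (pi_idY A).

Fact pi_compX (A B D : pi_alg) (g : pi_hom B D) (f : pi_hom A B) :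
  (pi_map g ∘ pi_map f) ∘ pi_strX A
  = pi_strX D ∘ fmap X (pi_map g ∘ pi_map f).
Proof. by rewrite fmapM -compA pi_mapX compA pi_mapX compA. Qed.
Fact pi_compY (A B D : pi_alg) (g : pi_hom B D) (f : pi_hom A B) :
  (pi_map g ∘ pi_map f) ∘ pi_strY A
  = pi_strY D ∘ fmap Y (pi_map g ∘ pi_map f).
Proof. by rewrite fmapM -compA pi_mapY compA pi_mapY compA. Qed.
Definition pi_comp A B D g f : pi_hom A D :=
  PiHom (@pi_compX A B D g f) (@pi_compY A B D g f).

Fact pi_comp1m A B (f : pi_hom A B) : pi_comp (pi_id B) f = f.
Proof. by apply: pi_hom_eq; apply: comp1m. Qed.
Fact pi_compm1 A B (f : pi_hom A B) : pi_comp f (pi_id A) = f.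
Proof. by apply: pi_hom_eq; apply: compm1. Qed.
Fact pi_compA A B D E (h : pi_hom D E) (g : pi_hom B D) (f : pi_hom A B) :
  pi_comp h (pi_comp g f) = pi_comp (pi_comp h g) f.
Proof. by apply: pi_hom_eq; apply: compA. Qed.

Definition pi_cat : category := Category pi_comp1m pi_compm1 pi_compA.

Definition pi_forget_ob (A : pi_alg) : alg X := @Alg C X (pi_ob A) (pi_strX A).

Definition pi_forget_map (A B : pi_alg) (f : pi_hom A B) :
    alg_hom (pi_forget_ob A) (pi_forget_ob B) :=
  @AlgHom C X (pi_forget_ob A) (pi_forget_ob B) (pi_map f) (pi_mapX f).

Fact pi_forget1 (A : pi_alg) :
  pi_forget_map (pi_id A) = alg_id (pi_forget_ob A).
Proof. exact: alg_hom_eq. Qed.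

Fact pi_forgetM (A B D : pi_alg) (g : pi_hom B D) (f : pi_hom A B) :
  pi_forget_map (pi_comp g f) = alg_comp (pi_forget_map g) (pi_forget_map f).
Proof. exact: alg_hom_eq. Qed.

Definition pi_forget : functor pi_cat (alg_cat X) :=
  @Functor pi_cat (alg_cat X) pi_forget_ob pi_forget_map pi_forget1 pi_forgetM.
End PiAlgebras.

(* Main.v *)
(* Over an X-algebra A with underlying object M, a map tau^-(A) -> A is a map
   out of f_!(Y M) that vanishes on f_!(M), and by freeness it is determined by
   its degree 0 component h' : Y M -> M. The vanishing condition only has to be
   tested on the degree 0 part of f_!(M), where it reads
   - h' h^♭ + h X(h') η = 0, that is, the relation of Pi(X). Dually, a map
   A -> tau(A) is a map M -> X M, the transpose of h' under Y ⊣ X, and the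
   degree 0 part of the condition is again the relation of Pi(X). *)
From mathcomp Require Import all_boot ssralg.
From mathcomp Require Import boolp.
Require Import Defs.

Set Implicit Arguments.
Unset Strict Implicit.
Unset Printing Implicit Defensive.

Import GRing.Theory.
Local Open Scope ring_scope.

(** * Strict isomorphisms of categories over a base category *)

Definition faithful (D B : category) (U : functor D B) : Prop :=
  forall (M N : D) (f g : hom M N), fmap U f = fmap U g -> f = g.

(** The object map [o] is shared, so [m] and [m'] have one type and no transport appears; the
    functor laws agree by proof irrelevance. *)
Lemma functor_ext (D B : category) (o : D -> B)
    (m m' : forall M N : D, hom M N -> hom (o M) (o N)) m1 m'1 mM m'M :
  (forall (M N : D) (f : hom M N), m M N f = m' M N f) ->
  @Functor D B o m m1 mM = @Functor D B o m' m'1 m'M.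
Proof.
move=> mm'; have {}mm' : m = m'.
  apply: functional_extensionality_dep => M.
  apply: functional_extensionality_dep => N.
  exact: functional_extensionality_dep (mm' M N).
case: _ / mm' m'1 m'M => m'1 m'M.
by rewrite (Prop_irrelevance m1 m'1) (Prop_irrelevance mM m'M).
Qed.

(** Pairing object map and morphism map gives an equality of dependent pairs. Its second component
    is transported along a proof of [o = o], which proof irrelevance replaces by [erefl]. *)
Lemma functor_fmap_inj (D B : category) (o : D -> B)
    (m m' : forall M N : D, hom M N -> hom (o M) (o N)) m1 m'1 mM m'M :
  @Functor D B o m m1 mM = @Functor D B o m' m'1 m'M -> m = m'.
Proof.
pose fmaps (p : D -> B) := forall M N : D, hom M N -> hom (p M) (p N).
move=> /(congr1 (fun F => existT fmaps (fob F) (@fmap D B F))) e.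
by have := projT2_eq e; rewrite (Prop_irrelevance (projT1_eq e) erefl).
Qed.

(** Agreement on objects lets both functors share one object map; on morphisms, [V] sends both
    images to the same arrow and faithfulness cancels [V]. *)
Lemma functor_over_ext (D E B : category) (V : functor E B) (F G : functor D E) :
  faithful V -> (forall M : D, F M = G M) -> fcomp V F = fcomp V G -> F = G.
Proof.
move=> faithV; case: F G => [o m m1 mM] [o' m' m'1 m'M] /= oo'.
have {}oo' : o = o' by exact: functional_extensionality_dep.
case: _ / oo' m' m'1 m'M => m' m'1 m'M VFG; apply: functor_ext => M N f.
apply: faithV; have VE := functor_fmap_inj VFG.
exact: (congr1 (fun m : forall M N, hom M N -> hom _ _ => m M N f) VE).
Qed.

(** Each composite lies over [B], as does the identity, so their equality reduces to the equality on
    objects given by [cancel]. *)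
Lemma cat_iso_over (D E B : category) (U : functor D B) (V : functor E B)
    (F : functor D E) (G : functor E D) :
  faithful U -> faithful V -> fcomp V F = U -> fcomp U G = V ->
  cancel F G -> cancel G F -> is_cat_iso F.
Proof.
have fcompA (P Q R S : category) (H : functor R S) (L : functor Q R)
    (M : functor P Q) : fcomp H (fcomp L M) = fcomp (fcomp H L) M.
  exact: functor_ext.
have fcomp1 (P Q : category) (H : functor P Q) : fcomp H (fid P) = H.
  by case: H => o m m1 mM; apply: functor_ext.
move=> faithU faithV VF UG FK GK; exists G; split.
  by apply: (functor_over_ext faithU) => //; rewrite fcompA UG VF fcomp1.
by apply: (functor_over_ext faithV) => //; rewrite fcompA VF UG fcomp1.
Qed.

(** * Faithfulness of the forgetful functors and equality of objects *)

Lemma alg_forget_faithful (C : category) (T : functor C C) :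
  faithful (alg_forget T).
Proof. by move=> A B f g fg; apply: alg_hom_eq. Qed.

Lemma coalg_forget_faithful (C : category) (T : functor C C) :
  faithful (coalg_forget T).
Proof. by move=> A B f g fg; apply: coalg_hom_eq. Qed.

Lemma pi_forget_faithful (C : category) (X Y : functor C C)
    (XY : adjunction X Y) (YX : adjunction Y X) :
  faithful (pi_forget XY YX).
Proof.
by move=> A B f g /(congr1 (fun h => alg_map h)) fg; apply: pi_hom_eq.
Qed.

(** Primitive projections make every object convertible to a constructor applied to its fields. With
    this lemma and its two analogues below, a round trip that keeps the underlying object is checked
    on one structure map alone. *)
Lemma alg_eq (C : category) (T : functor C C) (M : C) (h k : hom (T M) M) :
  h = k -> Alg h = Alg k.
Proof. by move=> ->. Qed.

Lemma coalg_eq (C : category) (T : functor C C) (M : C) (h k : hom M (T M)) :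
  h = k -> Coalg h = Coalg k.
Proof. by move=> ->. Qed.

Lemma pi_alg_eq (C : category) (X Y : functor C C)
    (XY : adjunction X Y) (YX : adjunction Y X) (M : C) (h : hom (X M) M)
    (k k' : hom (Y M) M) rel rel' :
  k = k' ->
  @PiAlg C X Y XY YX M h k rel = @PiAlg C X Y XY YX M h k' rel'.
Proof. by move=> kk'; case: _ / kk' rel' => rel'; congr PiAlg. Qed.

Lemma untranspose_inj (C D : preadditive) (F : functor C D) (G : functor D C)
    (adj : adjunction F G) (M : C) (N : D) :
  injective (@untranspose C D F G adj M N).
Proof. exact: (can_inj (untransposeK adj (M := M) (N := N))). Qed.

(** * Universal properties of f_! and f_* *)

Section FreeCofreeUniversal.
Variables (C : preadditive) (X Y : addfunctor C C).
Variables (XY : adjunction X Y) (YX : adjunction Y X).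
Variable BX : forall M : C, biproduct (fun i => fpow X i M).
Variable BY : forall M : C, biproduct (fun i => fpow Y i M).

Notation A_ := (alg_preadd X).

(** Degree i determines degree i + 1: [fshriek_str] carries X of the i-th inclusion to the next
    inclusion, and both maps commute with the structure maps. *)
Lemma fshriek_ext (N : C) (A : A_) (f g : hom (fshriek XY BX N : A_) A) :
  alg_map f ∘ binj (BX N) 0 = alg_map g ∘ binj (BX N) 0 -> f = g.
Proof.
move=> fg0; apply: alg_hom_eq; apply: bip_ext_in; elim=> [|i IH] //.
rewrite -(fshriek_str_inj BX N i) !compA.
have /= -> := alg_mapP f; have /= -> := alg_mapP g.
by rewrite -!compA -!fmapM; congr (_ ∘ fmap X _).
Qed.

(** The iterated action h X(h) ⋯ X^{i-1}(h) X^i(g), where h is the structure map of [A]. *)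
Fixpoint free_comp (N : C) (A : alg X) (g : hom N (alg_ob A)) (i : nat) :
    hom (fpow X i N) (alg_ob A) :=
  if i is k.+1 then
    alg_str A ∘ @fmap _ _ X (fpow X k N) (alg_ob A) (free_comp g k)
  else g.

(** Since [X] is a left adjoint, maps out of X(⨁ X^i N) are tested on X of the inclusions; there the
    equation is the recursion defining [free_comp]. *)
Fact free_lift_subproof (N : C) (A : alg X) (g : hom N (alg_ob A)) :
  bcopair (BX N) (free_comp g) ∘ fshriek_str BX N
  = alg_str A ∘ fmap X (bcopair (BX N) (free_comp g)).
Proof.
apply: (ladj_ext_in XY) => i.
rewrite -!compA fshriek_str_inj -fmapM.
have E j := bcopairE (BX N) (free_comp g) j.
by rewrite (E i.+1); congr (_ ∘ fmap X _); rewrite (E i).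
Qed.

Definition free_lift (N : C) (A : A_) (g : hom N (alg_ob A)) :
    hom (fshriek XY BX N : A_) A :=
  @AlgHom C X (fshriek_ob BX N) A _ (free_lift_subproof g).

Lemma free_lift_inj0 (N : C) (A : A_) (g : hom N (alg_ob A)) :
  alg_map (free_lift g) ∘ binj (BX N) 0 = g.
Proof. exact: (bcopairE (BX N) (free_comp g) 0). Qed.

(** Dual of [fshriek_ext]: compatibility with the adjoint structure maps [flat] recovers projection
    j + 1 from projection j. *)
Lemma fstar_ext (N : C) (A : A_) (f g : hom A (fstar XY BY N : A_)) :
  bprj (BY N) 0 ∘ alg_map f = bprj (BY N) 0 ∘ alg_map g -> f = g.
Proof.
move=> fg0; apply: alg_hom_eq; apply: bip_ext_out; elim=> [|j IH] //.
rewrite -(fstar_flat_prj BY N j) -!compA -(flat_fstar XY).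
have -> := hom_flat XY f; have -> := hom_flat XY g.
by rewrite !compA -!fmapM; congr (fmap Y _ ∘ _).
Qed.

(** The iterated coaction Y^j(p) Y^{j-1}(h^♭) ⋯ h^♭. *)
Fixpoint cofree_comp (N : C) (A : alg X) (p : hom (alg_ob A) N) (j : nat) :
    hom (alg_ob A) (fpow Y j N) :=
  if j is k.+1 then
    @fmap _ _ Y (alg_ob A) (fpow Y k N) (cofree_comp p k) ∘ flat XY A
  else p.

Fact cofree_lift_subproof (N : C) (A : alg X) (p : hom (alg_ob A) N) :
  bpair (BY N) (cofree_comp p) ∘ alg_str A
  = alg_str (fstar_ob XY BY N) ∘ fmap X (bpair (BY N) (cofree_comp p)).
Proof.
(* The structure map of f_*(N) is known through its adjoint, so the equation is transposed first;
   maps into Y(⨁ Y^j N) are then tested on projections, [Y] being a right adjoint. *)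
apply: (flat_hom (XY := XY) (B := fstar_ob XY BY N)); rewrite flat_fstar.
apply: (radj_ext_out XY) => j.
rewrite !compA fstar_flat_prj -fmapM.
have E k := bpairE (BY N) (cofree_comp p) k.
by rewrite (E j.+1); congr (fmap Y _ ∘ _); rewrite (E j).
Qed.

Definition cofree_lift (N : C) (A : A_) (p : hom (alg_ob A) N) :
    hom A (fstar XY BY N : A_) :=
  @AlgHom C X A (fstar_ob XY BY N) _ (cofree_lift_subproof p).

Lemma cofree_lift_prj0 (N : C) (A : A_) (p : hom (alg_ob A) N) :
  bprj (BY N) 0 ∘ alg_map (cofree_lift p) = p.
Proof. exact: (bpairE (BY N) (cofree_comp p) 0). Qed.

(** * The degree 0 conditions and the relation of Pi(X) *)

Lemma fshriek_inj1 (N : C) (A : A_) (f : hom (fshriek XY BX N : A_) A) :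
  alg_map f ∘ binj (BX N) 1
  = alg_str A ∘ fmap X (alg_map f ∘ binj (BX N) 0).
Proof.
rewrite -(fshriek_str_inj BX N 0) compA.
by have /= -> := alg_mapP f; rewrite -compA -fmapM.
Qed.

Lemma fstar_prj1 (N : C) (A : A_) (f : hom A (fstar XY BY N : A_)) :
  bprj (BY N) 1 ∘ alg_map f
  = fmap Y (bprj (BY N) 0 ∘ alg_map f) ∘ flat XY A.
Proof.
rewrite -(fstar_flat_prj BY N 0) -compA -(flat_fstar XY).
by have -> := hom_flat XY f; rewrite compA -fmapM.
Qed.

(** Out of degree 0, only the components into degrees 0 and 1 survive, and [pow_shift] is the
    identity there. *)
Lemma chim_map_inj0 (A : A_) :
  chim_map XY YX BX A ∘ binj (BX (alg_ob A)) 0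
  = binj (BX (Y (alg_ob A))) 1 ∘ unit YX (alg_ob A)
    - binj (BX (Y (alg_ob A))) 0 ∘ flat XY A.
Proof.
apply: bip_ext_out => j; rewrite compA chim_mapE /chim_comp /= addrC.
have E i := bprj_inj (BX (Y (alg_ob A))) i j.
rewrite compDr compmN !compA (E 1) (E 0).
rewrite !at_index_comp !comp1m; congr (_ + _).
have [<-|ne] := eqVneq 0 j; first by rewrite !at_index_eq.
by rewrite !at_index_neq // oppr0.
Qed.

Lemma chi_map_prj0 (A : A_) :
  bprj (BY (alg_ob A)) 0 ∘ chi_map YX BY A
  = counit YX (alg_ob A) ∘ bprj (BY (X (alg_ob A))) 1
    - alg_str A ∘ bprj (BY (X (alg_ob A))) 0.
Proof.
apply: bip_ext_in => i; rewrite chi_mapE /chi_comp addrC.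
have E j := bprj_inj (BY (X (alg_ob A))) i j.
rewrite compDl compNm -!compA (E 1) (E 0).
(* The counit summand is defined by cases on i and lands in degree i - 1, so it reaches degree 0
   only from i = 1. *)
case: i E => [|[|i]] _.
- by rewrite !at_index_eq at_index_neq // compm0 compm1 add0r.
- by rewrite !at_index_eq !at_index_neq // compm0 compm1 subr0 addr0.
- by rewrite !at_index_neq // !compm0 subr0 addr0.
Qed.

(** By [fshriek_ext] the composite vanishes as soon as its degree 0 component h_1 X(h) η - h h_1^♭
    does, and h_1^♭ is Y(h_1) η. *)
Lemma comp_chim_eq0 (A : A_) (f : hom (fshriek XY BX (Y (alg_ob A)) : A_) A)
    (h := alg_map f ∘ binj (BX (Y (alg_ob A))) 0) :
  f ∘ chim XY YX BX A = 0 <->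
  h ∘ fmap Y (alg_str A) ∘ unit XY (alg_ob A)
  = alg_str A ∘ fmap X h ∘ unit YX (alg_ob A).
Proof.
have -> : h ∘ fmap Y (alg_str A) ∘ unit XY (alg_ob A) = h ∘ flat XY A.
  by rewrite -compA /flat /transpose -lock.
have fE : alg_map (f ∘ chim XY YX BX A) ∘ binj (BX (alg_ob A)) 0
          = alg_str A ∘ fmap X h ∘ unit YX (alg_ob A) - h ∘ flat XY A.
  rewrite /= -compA chim_map_inj0 compDr compmN !compA.
  by rewrite (fshriek_inj1 f).
split=> [f0 | hE].
  by apply/esym/subr0_eq; rewrite -fE f0; apply: comp0m.
apply: fshriek_ext; rewrite fE hE subrr; exact/esym/comp0m.
Qed.

(** For p the degree 0 component of [f], the degree 0 component of the composite is ε Y(p) h_1^♭ -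
    h_1 p. Transposition along Y ⊣ X gives ε Y(p) = h and p = X(h) η. *)
Lemma chi_comp_eq0 (A : A_) (f : hom A (fstar XY BY (X (alg_ob A)) : A_))
    (h := untranspose YX (bprj (BY (X (alg_ob A))) 0 ∘ alg_map f)) :
  chi XY YX BY A ∘ f = 0 <->
  h ∘ fmap Y (alg_str A) ∘ unit XY (alg_ob A)
  = alg_str A ∘ fmap X h ∘ unit YX (alg_ob A).
Proof.
rewrite -(compA h) -(compA _ (fmap X h)).
rewrite [fmap Y _ ∘ unit XY _](_ : _ = flat XY A); last first.
  by rewrite /flat /transpose -lock.
rewrite [fmap X h ∘ _](_ : _ = transpose YX h); last first.
  by rewrite /transpose -lock.
have fE : bprj (BY (alg_ob A)) 0 ∘ alg_map (chi XY YX BY A ∘ f)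
          = h ∘ flat XY A - alg_str A ∘ transpose YX h.
  rewrite /= compA chi_map_prj0 compDl compNm -!compA /h untransposeK.
  by rewrite (fstar_prj1 f) /untranspose -lock -!compA.
split=> [f0 | hE].
  by apply/subr0_eq; rewrite -fE f0; apply: compm0.
apply: fstar_ext; rewrite fE hE subrr; exact/esym/compm0.
Qed.

(** * The isomorphism between (τ^- ⇓ Id) and C^Pi(X) *)

Section TaumAlgebras.
Variable Q : forall A : A_, cokernel (chim XY YX BX A).

Definition taum_strY (A : A_) (u : hom (taum Q A) A) :
    hom (Y (alg_ob A)) (alg_ob A) :=
  alg_map (u ∘ coker_mor (Q A)) ∘ binj (BX (Y (alg_ob A))) 0.

Fact taum_strY_rel (A : A_) (u : hom (taum Q A) A) :
  taum_strY u ∘ fmap Y (alg_str A) ∘ unit XY (alg_ob A)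
  = alg_str A ∘ fmap X (taum_strY u) ∘ unit YX (alg_ob A).
Proof. by apply/comp_chim_eq0; rewrite -compA coker_comp0 compm0. Qed.

Lemma taum_strY_inj (A : A_) : injective (@taum_strY A).
Proof. by move=> u v uv; apply: (coker_epi (Q := Q A)); apply: fshriek_ext. Qed.

(** Both sides on the right are degree 0 components of the two sides on the left, precomposed with
    the cokernel map. That map is epi and f_!(Y M) is free, so nothing is lost; each direction
    serves one of the two functors. *)
Lemma taum_strY_hom (A B : A_) (u : hom (taum Q A) A) (v : hom (taum Q B) B)
    (a : hom A B) :
  a ∘ u = v ∘ fmap (taum Q) a <->
  alg_map a ∘ taum_strY u = taum_strY v ∘ fmap Y (alg_map a).
Proof.
have uE : alg_map a ∘ taum_strY u
          = alg_map (a ∘ u ∘ coker_mor (Q A)) ∘ binj (BX (Y (alg_ob A))) 0.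
  by rewrite /taum_strY /= !compA.
have vE : taum_strY v ∘ fmap Y (alg_map a)
          = alg_map (v ∘ fmap (taum Q) a ∘ coker_mor (Q A))
            ∘ binj (BX (Y (alg_ob A))) 0.
  rewrite -(compA v) taum_mapE /taum_strY /= -!compA.
  (* In degree 0, f_!(Y a) is Y a itself. *)
  by rewrite (fshriek_map_inj BX (fmap Y (alg_map a)) 0).
rewrite uE vE; split=> [-> // | auv].
by apply: (coker_epi (Q := Q A)); apply: fshriek_ext.
Qed.

Definition pi_of_taum_ob (A : alg_cat (taum Q)) : pi_cat XY YX :=
  @PiAlg C X Y XY YX (alg_ob (alg_ob A)) (alg_str (alg_ob A))
    (taum_strY (alg_str A)) (taum_strY_rel (alg_str A)).

Definition pi_of_taum_hom (A B : alg_cat (taum Q)) (a : hom A B) :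
    hom (pi_of_taum_ob A) (pi_of_taum_ob B) :=
  @PiHom C X Y XY YX (pi_of_taum_ob A) (pi_of_taum_ob B)
    (alg_map (alg_map a)) (alg_mapP (alg_map a))
    ((taum_strY_hom _ _ _).1 (alg_mapP a)).

Fact pi_of_taum1 (A : alg_cat (taum Q)) :
  pi_of_taum_hom (idm A) = idm (pi_of_taum_ob A).
Proof. exact: pi_hom_eq. Qed.

Fact pi_of_taumM (A B D : alg_cat (taum Q)) (b : hom B D) (a : hom A B) :
  pi_of_taum_hom (b ∘ a) = pi_of_taum_hom b ∘ pi_of_taum_hom a.
Proof. exact: pi_hom_eq. Qed.

Definition pi_of_taum : functor (alg_cat (taum Q)) (pi_cat XY YX) :=
  Functor pi_of_taum1 pi_of_taumM.

(** The free extension of h_1' descends to the cokernel exactly because of the relation of Pi(X). *)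
Fact taum_of_pi_subproof (P : pi_cat XY YX) :
  free_lift (A := pi_forget XY YX P) (pi_strY P)
  ∘ chim XY YX BX (pi_forget XY YX P) = 0.
Proof. by apply/comp_chim_eq0; rewrite free_lift_inj0; apply: pi_rel. Qed.

Definition taum_of_pi_ob (P : pi_cat XY YX) : alg_cat (taum Q) :=
  @Alg _ (taum Q) (pi_forget XY YX P)
    (coker_desc (Q (pi_forget XY YX P)) (taum_of_pi_subproof P)).

(** This is one round trip; combined with [taum_strY_inj] it also yields the other. *)
Lemma taum_strY_of_pi (P : pi_cat XY YX) :
  taum_strY (alg_str (taum_of_pi_ob P)) = pi_strY P.
Proof.
rewrite /taum_strY; have -> := coker_descE _ (taum_of_pi_subproof P).
exact: free_lift_inj0.
Qed.

Fact taum_of_pi_hom_subproof (P R : pi_cat XY YX) (a : hom P R) :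
  fmap (pi_forget XY YX) a ∘ alg_str (taum_of_pi_ob P)
  = alg_str (taum_of_pi_ob R) ∘ fmap (taum Q) (fmap (pi_forget XY YX) a).
Proof. by apply/taum_strY_hom; rewrite !taum_strY_of_pi; apply: pi_mapY. Qed.

Definition taum_of_pi_hom (P R : pi_cat XY YX) (a : hom P R) :
    hom (taum_of_pi_ob P) (taum_of_pi_ob R) :=
  @AlgHom _ (taum Q) (taum_of_pi_ob P) (taum_of_pi_ob R)
    (fmap (pi_forget XY YX) a) (taum_of_pi_hom_subproof a).

Fact taum_of_pi1 (P : pi_cat XY YX) :
  taum_of_pi_hom (idm P) = idm (taum_of_pi_ob P).
Proof. by apply: alg_hom_eq; apply: (fmap1 (pi_forget XY YX)). Qed.

Fact taum_of_piM (P R S : pi_cat XY YX) (b : hom R S) (a : hom P R) :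
  taum_of_pi_hom (b ∘ a) = taum_of_pi_hom b ∘ taum_of_pi_hom a.
Proof. by apply: alg_hom_eq; apply: (fmapM (pi_forget XY YX)). Qed.

Definition taum_of_pi : functor (pi_cat XY YX) (alg_cat (taum Q)) :=
  Functor taum_of_pi1 taum_of_piM.

Lemma pi_of_taumK : cancel pi_of_taum taum_of_pi.
Proof.
by move=> A; apply: alg_eq; apply: taum_strY_inj; exact: taum_strY_of_pi.
Qed.

Lemma taum_of_piK : cancel taum_of_pi pi_of_taum.
Proof. by move=> P; apply: pi_alg_eq; exact: taum_strY_of_pi. Qed.

Lemma pi_forget_of_taum :
  fcomp (pi_forget XY YX) pi_of_taum = alg_forget (taum Q).
(* The record [alg_hom] is not primitive, so a rebuilt morphism equals the original by [alg_hom_eq]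
   and not by conversion. *)
Proof. by apply: functor_ext => A B a; apply: alg_hom_eq. Qed.

Lemma alg_forget_of_pi :
  fcomp (alg_forget (taum Q)) taum_of_pi = pi_forget XY YX.
Proof. exact: functor_ext. Qed.

Lemma pi_of_taum_iso : is_cat_iso pi_of_taum.
Proof.
apply: (cat_iso_over _ _ pi_forget_of_taum alg_forget_of_pi
          pi_of_taumK taum_of_piK).
- exact: alg_forget_faithful.
- exact: pi_forget_faithful.
Qed.
End TaumAlgebras.

(** * The isomorphism between C^Pi(X) and (Id ⇓ τ) *)

Section TauCoalgebras.
Variable K : forall A : A_, kernel (chi XY YX BY A).

Definition tau_strY (A : A_) (p : hom A (tau K A)) :
    hom (Y (alg_ob A)) (alg_ob A) :=
  untranspose YX
    (bprj (BY (X (alg_ob A))) 0 ∘ alg_map (ker_mor (K A) ∘ p)).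

Fact tau_strY_rel (A : A_) (p : hom A (tau K A)) :
  tau_strY p ∘ fmap Y (alg_str A) ∘ unit XY (alg_ob A)
  = alg_str A ∘ fmap X (tau_strY p) ∘ unit YX (alg_ob A).
Proof. by apply/chi_comp_eq0; rewrite compA ker_comp0 comp0m. Qed.

(** Transposition is injective, the kernel map is mono, and a map into f_* is determined in degree
    0. *)
Lemma tau_strY_inj (A : A_) : injective (@tau_strY A).
Proof.
move=> p q /(untranspose_inj (adj := YX)) pq.
by apply: (ker_mono (K := K A)); apply: fstar_ext.
Qed.

(** Naturality of [untranspose] in both variables absorbs [a], turning the right-hand equation into
    one between degree 0 components of maps into f_*(X(N)), with N the object under [B]. *)
Lemma tau_strY_hom (A B : A_) (p : hom A (tau K A)) (q : hom B (tau K B))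
    (a : hom A B) :
  q ∘ a = fmap (tau K) a ∘ p <->
  alg_map a ∘ tau_strY p = tau_strY q ∘ fmap Y (alg_map a).
Proof.
have pE : alg_map a ∘ tau_strY p
          = untranspose YX (bprj (BY (X (alg_ob B))) 0
                            ∘ alg_map (ker_mor (K B) ∘ (fmap (tau K) a ∘ p))).
  rewrite -untranspose_post [ker_mor (K B) ∘ _]compA tau_mapE /= !compA.
  by rewrite (fstar_map_prj BY (fmap X (alg_map a)) 0).
have qE : tau_strY q ∘ fmap Y (alg_map a)
          = untranspose YX (bprj (BY (X (alg_ob B))) 0
                            ∘ alg_map (ker_mor (K B) ∘ (q ∘ a))).
  by rewrite -untranspose_pre /= !compA.
rewrite pE qE; split=> [-> // | /(untranspose_inj (adj := YX)) apq].
by apply: (ker_mono (K := K B)); apply: fstar_ext.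
Qed.

Definition pi_of_tau_ob (A : coalg_cat (tau K)) : pi_cat XY YX :=
  @PiAlg C X Y XY YX (alg_ob (coalg_ob A)) (alg_str (coalg_ob A))
    (tau_strY (coalg_str A)) (tau_strY_rel (coalg_str A)).

Definition pi_of_tau_hom (A B : coalg_cat (tau K)) (a : hom A B) :
    hom (pi_of_tau_ob A) (pi_of_tau_ob B) :=
  @PiHom C X Y XY YX (pi_of_tau_ob A) (pi_of_tau_ob B)
    (alg_map (coalg_map a)) (alg_mapP (coalg_map a))
    ((tau_strY_hom _ _ _).1 (coalg_mapP a)).

Fact pi_of_tau1 (A : coalg_cat (tau K)) :
  pi_of_tau_hom (idm A) = idm (pi_of_tau_ob A).
Proof. exact: pi_hom_eq. Qed.

Fact pi_of_tauM (A B D : coalg_cat (tau K)) (b : hom B D) (a : hom A B) :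
  pi_of_tau_hom (b ∘ a) = pi_of_tau_hom b ∘ pi_of_tau_hom a.
Proof. exact: pi_hom_eq. Qed.

Definition pi_of_tau : functor (coalg_cat (tau K)) (pi_cat XY YX) :=
  Functor pi_of_tau1 pi_of_tauM.

(** The transpose M → X M of h_1' extends cofreely to a map into f_*(X M); the relation of Pi(X)
    makes it land in the kernel. *)
Fact tau_of_pi_subproof (P : pi_cat XY YX) :
  chi XY YX BY (pi_forget XY YX P)
  ∘ cofree_lift (A := pi_forget XY YX P) (transpose YX (pi_strY P)) = 0.
Proof.
apply/chi_comp_eq0; rewrite cofree_lift_prj0 transposeK; exact: pi_rel.
Qed.

Definition tau_of_pi_ob (P : pi_cat XY YX) : coalg_cat (tau K) :=
  @Coalg _ (tau K) (pi_forget XY YX P)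
    (ker_lift (K (pi_forget XY YX P)) (tau_of_pi_subproof P)).

Lemma tau_strY_of_pi (P : pi_cat XY YX) :
  tau_strY (coalg_str (tau_of_pi_ob P)) = pi_strY P.
Proof.
rewrite /tau_strY; have -> := ker_liftE _ (tau_of_pi_subproof P).
by rewrite cofree_lift_prj0 transposeK.
Qed.

Fact tau_of_pi_hom_subproof (P R : pi_cat XY YX) (a : hom P R) :
  coalg_str (tau_of_pi_ob R) ∘ fmap (pi_forget XY YX) a
  = fmap (tau K) (fmap (pi_forget XY YX) a) ∘ coalg_str (tau_of_pi_ob P).
Proof. by apply/tau_strY_hom; rewrite !tau_strY_of_pi; apply: pi_mapY. Qed.

Definition tau_of_pi_hom (P R : pi_cat XY YX) (a : hom P R) :
    hom (tau_of_pi_ob P) (tau_of_pi_ob R) :=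
  @CoalgHom _ (tau K) (tau_of_pi_ob P) (tau_of_pi_ob R)
    (fmap (pi_forget XY YX) a) (tau_of_pi_hom_subproof a).

Fact tau_of_pi1 (P : pi_cat XY YX) :
  tau_of_pi_hom (idm P) = idm (tau_of_pi_ob P).
Proof. by apply: coalg_hom_eq; apply: (fmap1 (pi_forget XY YX)). Qed.

Fact tau_of_piM (P R S : pi_cat XY YX) (b : hom R S) (a : hom P R) :
  tau_of_pi_hom (b ∘ a) = tau_of_pi_hom b ∘ tau_of_pi_hom a.
Proof. by apply: coalg_hom_eq; apply: (fmapM (pi_forget XY YX)). Qed.

Definition tau_of_pi : functor (pi_cat XY YX) (coalg_cat (tau K)) :=
  Functor tau_of_pi1 tau_of_piM.

Lemma pi_of_tauK : cancel pi_of_tau tau_of_pi.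
Proof.
by move=> A; apply: coalg_eq; apply: tau_strY_inj; exact: tau_strY_of_pi.
Qed.

Lemma tau_of_piK : cancel tau_of_pi pi_of_tau.
Proof. by move=> P; apply: pi_alg_eq; exact: tau_strY_of_pi. Qed.

Lemma pi_forget_of_tau :
  fcomp (pi_forget XY YX) pi_of_tau = coalg_forget (tau K).
Proof. by apply: functor_ext => A B a; apply: alg_hom_eq. Qed.

Lemma coalg_forget_of_pi :
  fcomp (coalg_forget (tau K)) tau_of_pi = pi_forget XY YX.
Proof. exact: functor_ext. Qed.

Lemma tau_of_pi_iso : is_cat_iso tau_of_pi.
Proof.
apply: (cat_iso_over _ _ coalg_forget_of_pi pi_forget_of_tau
          tau_of_piK pi_of_tauK).
- exact: pi_forget_faithful.
- exact: coalg_forget_faithful.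
Qed.
End TauCoalgebras.
End FreeCofreeUniversal.

Theorem theorem7p6 (C : preadditive) (C_abelian : is_abelian C)
    (X Y : addfunctor C C) (XY : adjunction X Y) (YX : adjunction Y X)
    (BX : forall M : C, biproduct (fun i : nat => fpow X i M))
    (BY : forall M : C, biproduct (fun i : nat => fpow Y i M))
    (K : forall A : alg_preadd X, kernel (chi XY YX BY A))
    (Q : forall A : alg_preadd X, cokernel (chim XY YX BX A)) :
  exists (F : functor (alg_cat (taum Q)) (pi_cat XY YX))
         (G : functor (pi_cat XY YX) (coalg_cat (tau K))),
    [/\ is_cat_iso F,
        is_cat_iso G,
        fcomp (pi_forget XY YX) F = alg_forget (taum Q)
      & fcomp (coalg_forget (tau K)) G = pi_forget XY YX].
Proof.
exists (pi_of_taum Q), (tau_of_pi K); split.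
- exact: pi_of_taum_iso.
- exact: tau_of_pi_iso.
- exact: pi_forget_of_taum.
- exact: coalg_forget_of_pi.
Qed.
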